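(* Let $\mu,\rho\in\mathbb{R}$ and let $\mathcal{S}_{\mu,\rho}$ be the class of all $(\mu,\rho)$-semimonotone operator pairs. Then $\mathcal{S}_{\mu,\rho}$ is SRG-full. Moreover, $$\mathcal{G}(\mathcal{S}_{\mu,\rho})=\begin{cases}\{z\in\mathbb{C}:\operatorname{Re}(z)\geq\mu+\rho|z|^2\}\cup\{\infty\}&\text{if }\rho\leq0,\\ \{z\in\mathbb{C}:\operatorname{Re}(z)\geq\mu+\rho|z|^2\}&\text{if }\rho>0.\end{cases}$$ In particular, for the class $\mathcal{M}_\mu=\mathcal{S}_{\mu,0}$ of $\mu$-monotone operator pairs, $\mathcal{G}(\mathcal{M}_\mu)=\{z\in\mathbb{C}:\operatorname{Re}(z)\geq\mu\}\cup\{\infty\}$.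
   Context: $\mathcal{H}$ denotes a real Hilbert space with inner product $\langle\cdot,\cdot\rangle$ and induced norm $\|\cdot\|$. Operator pairs $(A,B)$ consist of set-valued operators $A,B:\mathcal{H}\rightrightarrows\mathcal{H}$. For $A:\mathcal{H}\rightrightarrows\mathcal{H}$, $\operatorname{gph}A=\{(x,u)\in\mathcal{H}\times\mathcal{H}:u\in A(x)\}$ and $\operatorname{dom}A=\{x\in\mathcal{H}:A(x)\neq\emptyset\}$. $\overline{\mathbb{C}}=\mathbb{C}\cup\{\infty\}$. Semimonotone pairs: for $A,B:\mathcal{H}\rightrightarrows\mathcal{H}$ and $\mu,\rho\in\mathbb{R}$, the pair $(A,B)$ is $(\mu,\rho)$-semimonotone if $\langle u_A-\bar u_A,u_B-\bar u_B\rangle\geq\mu\|u_B-\bar u_B\|^2+\rho\|u_A-\bar u_A\|^2$ for all $(x,u_A),(\bar x,\bar u_A)\in\operatorname{gph}A$ and $(x,u_B),(\bar x,\bar u_B)\in\operatorname{gph}B$. Scaled relative graph (SRG) of a pair: for $a,b\in\mathcal{H}$ with $b\neq0$ let $z_\pm(a,b)=\frac{\|a\|}{\|b\|}\exp(\pm i\angle(b,a))$ (a complex-conjugate pair), where $\angle(b,a)=\arccos\frac{\langle b,a\rangle}{\|b\|\|a\|}\in[0,\pi]$ if $a\neq0$ and $b\neq0$, and $\angle(b,a)=0$ otherwise. For $A,B:\mathcal{H}\rightrightarrows\mathcal{H}$, $\mathcal{G}(A,B)\subseteq\overline{\mathbb{C}}$ consists of all points $z_\pm(u_A-\bar u_A,u_B-\bar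 u_B)$ (both signs) with $x,\bar x\in\operatorname{dom}A\cap\operatorname{dom}B$, $u_A\in A(x)$, $\bar u_A\in A(\bar x)$, $u_B\in B(x)$, $\bar u_B\in B(\bar x)$ and $u_B\neq\bar u_B$; additionally, $\mathcal{G}(A,B)$ includes $\infty$ exactly when there exist $(x,u_A),(\bar x,\bar u_A)\in\operatorname{gph}A$ and $(x,u_B),(\bar x,\bar u_B)\in\operatorname{gph}B$ (possibly $x=\bar x$) with $u_B=\bar u_B$ and $u_A\neq\bar u_A$. For a class $\mathcal{P}$ of operator pairs, $\mathcal{G}(\mathcal{P})=\bigcup_{(A,B)\in\mathcal{P}}\mathcal{G}(A,B)$. The class $\mathcal{P}$ is SRG-full if, for operator pairs $(A,B)$, $(A,B)\in\mathcal{P}\iff\mathcal{G}(A,B)\subseteq\mathcal{G}(\mathcal{P})$.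
   Formalization: The formulas for the SRG of the class fail on a fixed Hilbert space of dimension at most 1 (on ℝ all finite SRG points are real), so they are proved for each space of dimension at least 2 and for the class over all real Hilbert spaces; SRG-fullness is proved for every space. *)

(* Defs.v *)
From HB Require Import structures.
From mathcomp Require Import all_boot all_order all_algebra.
From mathcomp Require Import sesquilinear complex.
From mathcomp Require Import all_classical all_reals all_analysis.
Set Implicit Arguments.
Unset Strict Implicit.
Unset Printing Implicit Defensive.
Import Order.TTheory GRing.Theory Num.Theory.
Import numFieldNormedType.Exports.

Local Open Scope classical_set_scope.
Local Open Scope ring_scope.
Local Open Scope complex_scope.

(* [{dot _ for idfun}] is the type of symmetric positive definite bilinear
   forms; the norm of the complete normed module is the induced one. *)
Record hilbertSpace (R : realType) := HilbertSpace {
  hilbert_carrier :> completeNormedModType R ;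
  inner : {dot hilbert_carrier for idfun} ;
  inner_norm : forall x : hilbert_carrier, inner x x = `|x| ^+ 2
}.

Notation "'⟨' x , y '⟩'" := (inner _ x y) (at level 0, x, y at level 99).

Definition operator (R : realType) (H : hilbertSpace R) : Type := H -> set H.

(* The extended complex plane: [Some z] is the finite point z, [None] is the
   point at infinity. *)
Definition extC (R : realType) : Type := one_point_compactification R[i].

Section FixedSpace.
Context {R : realType} {H : hilbertSpace R}.
Implicit Types (A B : operator H) (a b : H).

Definition gph A : set (H * H) := [set p | A p.1 p.2].

Definition dom A : set H := [set x | A x !=set0].

Definition semimonotone (mu rho : R) A B : Prop :=
  forall x x' uA uA' uB uB' : H,
    gph A (x, uA) -> gph A (x', uA') -> gph B (x, uB) -> gph B (x', uB') ->
    mu * `|uB - uB'| ^+ 2 + rho * `|uA - uA'| ^+ 2 <= ⟨uA - uA', uB - uB'⟩.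

Definition angle b a : R :=
  if (a != 0) && (b != 0) then acos (⟨b, a⟩ / (`|b| * `|a|)) else 0.

(* exp (i t) *)
Definition expi (t : R) : R[i] := cos t +i* sin t.

Definition z_plus a b : R[i] := (`|a| / `|b|)%:C * expi (angle b a).

Definition z_minus a b : R[i] := (`|a| / `|b|)%:C * expi (- angle b a).

Definition srg_finite A B : set R[i] := [set z |
  exists x x' uA uA' uB uB' : H,
    [/\ (dom A `&` dom B) x /\ (dom A `&` dom B) x',
        A x uA /\ A x' uA',
        B x uB /\ B x' uB',
        uB <> uB'
      & z = z_plus (uA - uA') (uB - uB') \/ z = z_minus (uA - uA') (uB - uB')]].

Definition srg_infinite A B : Prop :=
  exists x x' uA uA' uB uB' : H,
    [/\ gph A (x, uA) /\ gph A (x', uA'),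
        gph B (x, uB) /\ gph B (x', uB'),
        uB = uB'
      & uA <> uA'].

Definition srg A B : set (extC R) := [set w |
  match w with Some z => srg_finite A B z | None => srg_infinite A B end].

Definition srg_of_class_on (P : set (operator H * operator H)) :
    set (extC R) :=
  \bigcup_(p in P) srg p.1 p.2.

Definition srg_full_on (P : set (operator H * operator H)) : Prop :=
  forall A B, P (A, B) <-> srg A B `<=` srg_of_class_on P.

End FixedSpace.

(* A class of operator pairs whose members may live on different real Hilbert
   spaces: [P H] is the set of its members on [H]. *)
Definition pair_class (R : realType) : Type :=
  forall H : hilbertSpace R, set (operator H * operator H).

Definition srg_of_class (R : realType) (P : pair_class R) : set (extC R) :=
  [set w | exists (H : hilbertSpace R) (A B : operator H),
     P H (A, B) /\ srg A B w].

Definition srg_full (R : realType) (P : pair_class R) : Prop :=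
  forall (H : hilbertSpace R) (A B : operator H),
    P H (A, B) <-> srg A B `<=` srg_of_class P.

Definition semimonotone_class (R : realType) (mu rho : R) : pair_class R :=
  fun H => [set p | semimonotone mu rho p.1 p.2].

Definition monotone_class (R : realType) (mu : R) : pair_class R :=
  semimonotone_class mu 0.

Arguments semimonotone_class {R} mu rho H _.
Arguments monotone_class {R} mu H _.

Definition dim_ge2 (R : realType) (H : hilbertSpace R) : Prop :=
  exists u v : H, forall s t : R, s *: u + t *: v = 0 -> s = 0 /\ t = 0.

Definition finite_points (R : realType) (D : set R[i]) : set (extC R) :=
  [set Some z | z in D].

Definition infty (R : realType) : extC R := None.

(* [normc z] is |z| as an element of R (MathComp's [`|z|] lives in R[i]). *)
Notation normc := ComplexField.Normc.normc.

(* Main.v *)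
(* Writing z for either point z_±(a, b), one has Re z = <a, b> / |b|^2 and
   |z| = |a| / |b|, so dividing the semimonotonicity inequality by |b|^2 gives
   Re z >= mu + rho |z|^2; when b = 0 and a <> 0 the inequality says rho <= 0.
   Hence a pair is semimonotone iff its SRG lies in the claimed region, and
   fullness follows.  Conversely each point of the region is attained: a finite
   z by a pair of linear operators of rank one in a plane, and infinity by the
   normal cone of {0} paired with the zero operator on {0}. *)
Require Import Defs.
From HB Require Import structures.
From mathcomp Require Import all_boot all_order all_algebra.
From mathcomp Require Import sesquilinear complex.
From mathcomp Require Import all_classical all_reals all_analysis.
From mathcomp Require Import ring lra.
Import Order.TTheory GRing.Theory Num.Theory.
Import numFieldNormedType.Exports.
Local Open Scope classical_set_scope.
Local Open Scope ring_scope.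

(** * Complex conjugation, real part and modulus *)

Lemma normc_conjc {R : realType} (z : R[i]) : normc (conjc z) = normc z.
Proof. by case: z => x y /=; rewrite sqrrN. Qed.

Lemma Re_conjc {R : realType} (z : R[i]) : complex.Re (conjc z) = complex.Re z.
Proof. by case: z. Qed.

(** Equal moduli and equal real parts force equal squares of the imaginary parts, hence equality up
    to sign. *)
Lemma eq_or_conjc {R : realType} (z w : R[i]) : complex.Re z = complex.Re w ->
  normc z = normc w -> z = w \/ z = conjc w.
Proof.
case: z w => [a b] [c d] /= -> /(congr1 (fun t => t ^+ 2)).
rewrite !sqr_sqrtr ?addr_ge0 ?sqr_ge0// => /addrI/eqP.
by rewrite eqf_sqr => /orP[]/eqP->; [left|right].
Qed.

(** * Inner products, angles and the points z_± *)

Section InnerProduct.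
Context {R : realType} {H : hilbertSpace R}.
Implicit Types a b x y : H.

Lemma innerC x y : ⟨ x, y ⟩ = ⟨ y, x ⟩.
Proof. by have := hermC (inner H) x y; rewrite expr0 mul1r. Qed.

Lemma innerDr x y z : ⟨ x, y + z ⟩ = ⟨ x, y ⟩ + ⟨ x, z ⟩.
Proof. exact: linearD. Qed.

Lemma innerZr x (l : R) y : ⟨ x, l *: y ⟩ = l * ⟨ x, y ⟩.
Proof. exact: linearZ. Qed.

Lemma innerDl x y z : ⟨ x + y, z ⟩ = ⟨ x, z ⟩ + ⟨ y, z ⟩.
Proof. by rewrite innerC innerDr !(innerC z). Qed.

Lemma innerZl (l : R) x y : ⟨ l *: x, y ⟩ = l * ⟨ x, y ⟩.
Proof. by rewrite innerC innerZr innerC. Qed.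

Lemma inner0l x : ⟨ 0, x ⟩ = 0.
Proof. by rewrite -(scale0r 0) innerZl mul0r. Qed.

Lemma inner0r x : ⟨ x, 0 ⟩ = 0.
Proof. by rewrite innerC inner0l. Qed.

Lemma innerNl x y : ⟨ - x, y ⟩ = - ⟨ x, y ⟩.
Proof. by rewrite -scaleN1r innerZl mulN1r. Qed.

Lemma innerNr x y : ⟨ x, - y ⟩ = - ⟨ x, y ⟩.
Proof. by rewrite innerC innerNl innerC. Qed.

(* Cauchy-Schwarz, read off from the triangle inequality for the norm. *)
Lemma inner_le x y : ⟨ x, y ⟩ <= `|x| * `|y|.
Proof.
have : `|x + y| ^+ 2 <= (`|x| + `|y|) ^+ 2.
  by rewrite ler_sqr ?nnegrE ?addr_ge0// ler_normD.
rewrite -inner_norm innerDl !innerDr (innerC y x) !inner_norm sqrrD; lra.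
Qed.

Lemma inner_ge x y : - (`|x| * `|y|) <= ⟨ x, y ⟩.
Proof. by rewrite lerNl -innerNl -(normrN x) inner_le. Qed.

(** Cauchy-Schwarz puts the argument of [acos] in [-1, 1], so the cosine undoes it; for a = 0, where
    the angle is 0 by convention, both sides vanish. *)
Lemma norm_cos_angle a b : b != 0 ->
  `|a| / `|b| * cos (angle b a) = ⟨ a, b ⟩ / `|b| ^+ 2.
Proof.
move=> b0; have nb0 : `|b| != 0 by rewrite normr_eq0.
rewrite /angle b0 andbT; case: eqVneq => [->|a0] /=.
  by rewrite normr0 inner0l !mul0r.
have na0 : `|a| != 0 by rewrite normr_eq0.
have ba0 : 0 < `|b| * `|a| by rewrite mulr_gt0 ?normr_gt0.
rewrite acosK; last first.
  by rewrite in_itv/= ler_pdivlMr// ler_pdivrMr// mulN1r mul1r inner_ge inner_le.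
rewrite innerC; move: ⟨ a, b ⟩ `|a| `|b| nb0 na0 => t n m m0 n0 {ba0}.
by field; rewrite m0 n0.
Qed.

Lemma Re_z_plus a b : b != 0 ->
  complex.Re (z_plus a b) = ⟨ a, b ⟩ / `|b| ^+ 2.
Proof. by move=> b0; rewrite -norm_cos_angle//= mul0r subr0. Qed.

Lemma z_minusE a b : z_minus a b = conjc (z_plus a b).
Proof. by rewrite /z_minus /z_plus /expi cosN sinN /=; simpc. Qed.

Lemma normc_z_plus a b : normc (z_plus a b) = `|a| / `|b|.
Proof.
rewrite /z_plus ComplexField.Normc.normcM /= cos2Dsin2 sqrtr1 mulr1.
by rewrite expr0n addr0 sqrtr_sqr ger0_norm// divr_ge0.
Qed.

Lemma semimonotone_pointP (mu rho : R) a b : b != 0 ->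
  (mu * `|b| ^+ 2 + rho * `|a| ^+ 2 <= ⟨ a, b ⟩) <->
  (mu + rho * normc (z_plus a b) ^+ 2 <= complex.Re (z_plus a b)).
Proof.
move=> b0; have nb0 : 0 < `|b| by rewrite normr_gt0.
rewrite Re_z_plus// normc_z_plus ler_pdivlMr ?exprn_gt0//.
by rewrite mulrDl -mulrA exprMn exprVn mulfVK// expf_neq0// gt_eqF.
Qed.

Lemma dim_ge2_orthonormal : dim_ge2 H ->
  exists e f : H, [/\ `|e| = 1, `|f| = 1 & ⟨ e, f ⟩ = 0].
Proof.
have normalize x : x != 0 -> `| `|x|^-1 *: x| = 1.
  by move=> x0; rewrite normrZ normfV normr_id mulVf// normr_eq0.
move=> [u [v uv]].
have u0 : u != 0.
  apply/eqP => u0; have [] := uv 1 0; last by move/eqP; rewrite oner_eq0.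
  by rewrite u0 scaler0 scale0r addr0.
(* Gram-Schmidt: c u is the orthogonal projection of v onto u, and v = c u would be a linear
   dependence with coefficients -c and 1. *)
pose c := ⟨ u, v ⟩ / `|u| ^+ 2.
have w0 : v - c *: u != 0.
  apply/eqP => w0; have [] := uv (- c) 1.
    by rewrite scale1r scaleNr addrC.
  by move=> _ /eqP; rewrite oner_eq0.
exists (`|u|^-1 *: u), (`|v - c *: u|^-1 *: (v - c *: u)); split.
- exact: normalize.
- exact: normalize.
- rewrite innerZl innerZr innerDr innerNr innerZr inner_norm /c.
  by rewrite mulfVK ?expf_neq0 ?normr_eq0// subrr !mulr0.
Qed.

End InnerProduct.

(** * The region and its relation to semimonotone pairs *)

Definition semimonotone_region {R : realType} (mu rho : R) : set (extC R) :=
  [set w | match w with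
           | Some z => mu + rho * normc z ^+ 2 <= complex.Re z
           | None => rho <= 0
           end].

(** The case split on the sign of rho is confined to this rewriting; elsewhere it is carried by the
    membership of infinity. *)
Lemma semimonotone_regionE {R : realType} (mu rho : R) :
  semimonotone_region mu rho =
    if rho <= 0
    then finite_points
           [set z : R[i] | complex.Re z >= mu + rho * normc z ^+ 2]
         `|` [set infty R]
    else finite_points
           [set z : R[i] | complex.Re z >= mu + rho * normc z ^+ 2].
Proof.
case: ifPn => rho0; apply/seteqP; split=> -[z|] /=.
- by move=> ?; left; exists z.
- by right.
- by case=> [[y ? [<-]]|].
- by [].
- by move=> ?; exists z.
- by rewrite (negbTE rho0).
- by case=> [y ? [<-]].
- by case.
Qed.

Section Semimonotone.
Context {R : realType} {H : hilbertSpace R}.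
Implicit Types (A B : operator H) (mu rho : R).

Lemma semimonotone_srgP mu rho A B :
  semimonotone mu rho A B <-> srg A B `<=` semimonotone_region mu rho.
Proof.
split=> [AB [z|] /=|AB x x' a a' b b' Aa Aa' Bb Bb'].
- move=> [x [x' [a [a' [b [b' [_ [Aa Aa'] [Bb Bb'] /eqP bb']]]]]]].
  rewrite -subr_eq0 in bb'.
  have /(semimonotone_pointP _ _ _ _ bb') := AB _ _ _ _ _ _ Aa Aa' Bb Bb'.
  by move=> h [->//|->]; rewrite z_minusE normc_conjc Re_conjc.
- move=> [x [x' [a [a' [b [b' [[Aa Aa'] [Bb Bb'] bb' /eqP aa']]]]]]].
  have := AB _ _ _ _ _ _ Aa Aa' Bb Bb'.
  rewrite -subr_eq0 in aa'.
  rewrite bb' subrr inner0r normr0 expr0n mulr0 add0r.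
  by rewrite pmulr_lle0// exprn_gt0// normr_gt0.
- have [bb'|bb'] := eqVneq b b'.
    rewrite bb' subrr inner0r normr0 expr0n mulr0 add0r.
    have [->|/eqP aa'] := eqVneq a a'.
      by rewrite subrr normr0 expr0n mulr0.
    (* Here the values of B agree and those of A differ, so infinity lies in the SRG and the region
       yields rho <= 0. *)
    rewrite mulr_le0_ge0 ?sqr_ge0//; apply: (AB None).
    by exists x, x', a, a', b, b'.
  have bb0 : b - b' != 0 by rewrite subr_eq0.
  apply/(semimonotone_pointP _ _ _ _ bb0).
  apply: (AB (Some (z_plus (a - a') (b - b')))).
  exists x, x', a, a', b, b'; split=> //; last by left.
  - by split; split; [exists a|exists b|exists a'|exists b'].
  - exact/eqP.
Qed.

Lemma semimonotone_region_srg mu rho (w : extC R) : dim_ge2 H ->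
  semimonotone_region mu rho w ->
  exists A B, semimonotone mu rho A B /\ srg A B w.
Proof.
move=> /dim_ge2_orthonormal[e [f [e1 f1 ef]]].
have e0 : e != 0 by rewrite -normr_eq0 e1 oner_eq0.
case: w => [z|] /= zw; last first.
  (* Both domains are {0}. All values of B are 0, so the inequality reduces to rho |u_A - u_A'|^2 <=
     0; the values e and 0 of A at 0 produce infinity. *)
  exists (fun x _ => x = 0), (fun x u => x = 0 /\ u = 0); split.
    move=> x x' a a' b b' _ _ [_ /= ->] [_ /= ->].
    rewrite subrr inner0r normr0 expr0n mulr0 add0r.
    by rewrite mulr_le0_ge0 ?sqr_ge0.
  by exists 0, 0, e, 0, 0, 0; split=> //; exact/eqP.
(* The copy of z in the plane of e and f, with e in the role of 1: then <a, e> = Re z and |a| =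
   |z|. *)
pose a := complex.Re z *: e + complex.Im z *: f.
have ae : ⟨ a, e ⟩ = complex.Re z.
  by rewrite innerDl !innerZl (innerC f) ef inner_norm e1 expr1n mulr1 mulr0 addr0.
have na : `|a| = normc z.
  rewrite -[LHS]ger0_norm// -sqrtr_sqr -inner_norm innerDl !innerDr !innerZl.
  rewrite !innerZr (innerC f) ef !inner_norm e1 f1.
  by case: z {zw a ae} => x y /=; congr Num.sqrt; ring.
have Rez : complex.Re (z_plus a e) = complex.Re z.
  by rewrite Re_z_plus// ae e1 expr1n divr1.
have nz : normc (z_plus a e) = normc z by rewrite normc_z_plus na e1 divr1.
have ineq : mu * `|e| ^+ 2 + rho * `|a| ^+ 2 <= ⟨ a, e ⟩.
  by apply/semimonotone_pointP => //; rewrite Rez nz.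
(* Differences of values of [A a] and [A e] are s a and s e with the same s = <x - x', e>, so
   semimonotonicity is the inequality for (a, e) multiplied by s^2. *)
pose A (c : H) : operator H := fun x u => u = ⟨ x, e ⟩ *: c.
exists (A a), (A e); split.
  move=> x x' ? ? ? ?; rewrite /gph /A /= => -> -> -> ->; rewrite -!scalerBl.
  rewrite innerZl innerZr !normrZ !exprMn -normrX ger0_norm ?sqr_ge0//.
  set s := _ - _; have := ler_wpM2l (sqr_ge0 s) ineq; lra.
have Ae c : A c e c by rewrite /A inner_norm e1 expr1n scale1r.
have A0 c : A c 0 0 by rewrite /A inner0l scale0r.
exists e, 0, a, 0, e, 0; rewrite !subr0; split=> //.
- by split; split; [exists a|exists e|exists 0|exists 0].
- exact/eqP.
(* Real part and modulus determine z only up to conjugation, which is why both signs z_± are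
   offered. *)
- by rewrite z_minusE; exact: eq_or_conjc.
Qed.

End Semimonotone.

(** * The Euclidean plane as a real Hilbert space *)

Definition plane (R : realType) : Type := (R^o * R^o)%type.

(** Only the module structure is copied: the product itself carries the maximum norm, which no inner
    product induces. *)
HB.instance Definition _ (R : realType) :=
  GRing.Lmodule.copy (plane R) (R^o * R^o)%type.

Definition plane_dot (R : realType) (x y : plane R) : R :=
  x.1 * y.1 + x.2 * y.2.

Definition plane_norm (R : realType) (x : plane R) : R :=
  Num.sqrt (plane_dot R x x).

Section Plane.
Context {R : realType}.
Implicit Types x y : plane R.

Lemma plane_dot_ge0 x : 0 <= plane_dot R x x.
Proof. by rewrite addr_ge0// -expr2 sqr_ge0. Qed.

Lemma sqr_plane_norm x : plane_norm R x ^+ 2 = plane_dot R x x.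
Proof. exact/sqr_sqrtr/plane_dot_ge0. Qed.

Lemma plane_norm_ge0 x : 0 <= plane_norm R x.
Proof. exact: sqrtr_ge0. Qed.

Lemma plane_normD x y :
  plane_norm R (x + y) <= plane_norm R x + plane_norm R y.
Proof.
have x0 := plane_norm_ge0 x; have y0 := plane_norm_ge0 y.
rewrite -ler_sqr ?nnegrE ?addr_ge0 ?plane_norm_ge0// sqrrD !sqr_plane_norm.
have : plane_dot R x y <= plane_norm R x * plane_norm R y.
  apply: le_trans (ler_norm _) _.
  rewrite -ler_sqr ?nnegrE ?mulr_ge0// exprMn !sqr_plane_norm (real_normK (num_real _)).
  rewrite /plane_dot.
  (* Lagrange's identity: |x|^2 |y|^2 - <x, y>^2 is the square of this determinant. *)
  have := sqr_ge0 (x.1 * y.2 - x.2 * y.1); lra.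
rewrite /plane_dot /=; lra.
Qed.

Lemma plane_normZ (l : R) x : plane_norm R (l *: x) = `|l| * plane_norm R x.
Proof.
rewrite /plane_norm -sqrtr_sqr -sqrtrM ?sqr_ge0//; congr Num.sqrt.
by rewrite /plane_dot /= /GRing.scale /=; ring.
Qed.

Lemma plane_dot_eq0 x : plane_dot R x x = 0 -> x = 0.
Proof.
move=> /eqP; rewrite /plane_dot paddr_eq0 -?expr2 ?sqr_ge0// !sqrf_eq0.
by case: x => [a b] /= /andP[/eqP-> /eqP->].
Qed.

Lemma plane_norm_eq0 x : plane_norm R x = 0 -> x = 0.
Proof.
by move=> x0; apply: plane_dot_eq0; rewrite -sqr_plane_norm x0 expr0n.
Qed.

HB.instance Definition _ := Lmodule_isNormed.Build R (plane R)
  plane_normD plane_normZ plane_norm_eq0.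

Lemma plane_normE x : `|x| = plane_norm R x. Proof. by []. Qed.

Lemma plane_norm_fst x : `|x.1 : R| <= `|x|.
Proof.
rewrite plane_normE -sqrtr_sqr ler_wsqrtr// /plane_dot -!expr2.
by rewrite lerDl sqr_ge0.
Qed.

Lemma plane_norm_snd x : `|x.2 : R| <= `|x|.
Proof.
rewrite plane_normE -sqrtr_sqr ler_wsqrtr// /plane_dot -!expr2.
by rewrite lerDr sqr_ge0.
Qed.

Lemma plane_norm_le x : `|x| <= `|x.1 : R| + `|x.2 : R|.
Proof.
rewrite -ler_sqr ?nnegrE ?addr_ge0// plane_normE sqr_plane_norm sqrrD.
rewrite !(real_normK (num_real _)) /plane_dot -!expr2 -addrA lerD2l lerDr.
by rewrite mulrn_wge0// mulr_ge0.
Qed.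

(** A map that does not increase distances sends Cauchy filters to Cauchy filters, and R is
    complete; used for the two coordinates. *)
Lemma cauchy_lipschitz1 (f : plane R -> R) (F : set_system (plane R)) :
  (forall x y, `|f x - f y| <= `|x - y|) ->
  ProperFilter F -> cauchy F -> cvg (f @ F).
Proof.
move=> fl FF /cauchy_ballP Fc; apply: cauchy_cvg; apply/cauchy_ballP => e e0.
have := Fc e e0.
rewrite !near_simpl => -[[A B]/= [FA FB] AB]; exists (f @` A, f @` B) => /=.
  by split; [apply: filterS FA|apply: filterS FB] => x ? /=; exists x.
move=> [_ _]/= [[x Ax <-] [y By <-]] /=.
have := AB (x, y) (conj Ax By); rewrite -!ball_normE /=.
exact: le_lt_trans.
Qed.

Lemma plane_complete (F : set_system (plane R)) :
  ProperFilter F -> cauchy F -> cvg F.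
Proof.
move=> FF Fc.
have /cvg_ex[a Fa] : cvg ((fun x : plane R => x.1 : R) @ F).
  by apply: cauchy_lipschitz1 => // x y; exact: (plane_norm_fst (x - y)).
have /cvg_ex[b Fb] : cvg ((fun x : plane R => x.2 : R) @ F).
  by apply: cauchy_lipschitz1 => // x y; exact: (plane_norm_snd (x - y)).
(* The limit is taken coordinatewise; the norm is at most the sum of the coordinate errors, each
   below e/2. *)
apply/cvg_ex; exists ((a, b) : plane R); apply/cvgrPdist_lt => e e0.
near=> x; apply: le_lt_trans (plane_norm_le _) _ => /=.
rewrite [e]splitr ltrD//; near: x.
- by move/cvgrPdist_lt : Fa; apply; rewrite divr_gt0.
- by move/cvgrPdist_lt : Fb; apply; rewrite divr_gt0.
Unshelve. all: by end_near. Qed.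

HB.instance Definition _ := Uniform_isComplete.Build (plane R) plane_complete.

Lemma plane_dot_bilinear : bilinear_for
  (GRing.Scale.Law.clone _ _ *%R _)
  (GRing.Scale.Law.clone _ _ (idfun \; *%R) _) (plane_dot R).
Proof.
by split=> [y|y] l x z; rewrite /plane_dot /= /GRing.scale /=; ring.
Qed.

HB.instance Definition _ := bilinear_isBilinear.Build R (plane R) (plane R) R
  _ _ (plane_dot R) plane_dot_bilinear.

Lemma plane_dotC x y :
  plane_dot R x y = (-1) ^+ false * idfun (plane_dot R y x).
Proof. by rewrite expr0 mul1r /plane_dot /= mulrC [X in _ + X]mulrC. Qed.

HB.instance Definition _ := isHermitianSesquilinear.Build R (plane R)
  false idfun (plane_dot R) plane_dotC.

Lemma plane_dot_gt0 x : x != 0 -> 0 < plane_dot R x x.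
Proof.
move=> x0; rewrite lt_neqAle plane_dot_ge0 andbT eq_sym.
by apply: contra_neq x0; exact: plane_dot_eq0.
Qed.

HB.instance Definition _ := isDotProduct.Build R (plane R)
  (plane_dot R) plane_dot_gt0.

Lemma plane_dot_norm x : plane_dot R x x = `|x| ^+ 2.
Proof. by rewrite plane_normE sqr_plane_norm. Qed.

End Plane.

Definition hilbert_plane (R : realType) : hilbertSpace R :=
  @HilbertSpace R (plane R) (@plane_dot R) plane_dot_norm.

Lemma dim_ge2_hilbert_plane (R : realType) : dim_ge2 (hilbert_plane R).
Proof.
exists ((1, 0) : plane R), ((0, 1) : plane R) => s t [] /=.
by rewrite /GRing.scale /= !mulr0 !mulr1 addr0 add0r.
Qed.

(** * The SRG of the classes and fullness *)

Lemma srg_of_class_on_semimonotone {R : realType} {H : hilbertSpace R}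
    (mu rho : R) : dim_ge2 H ->
  srg_of_class_on (semimonotone_class mu rho H) = semimonotone_region mu rho.
Proof.
move=> H2; apply/seteqP; split=> w.
  by move=> [[A B] /= /semimonotone_srgP]; exact.
by move=> /(semimonotone_region_srg _ _ _ H2)[A [B [AB ABw]]]; exists (A, B).
Qed.

(** The plane alone already attains every point of the region. *)
Lemma srg_of_class_semimonotone {R : realType} (mu rho : R) :
  srg_of_class (semimonotone_class mu rho) = semimonotone_region mu rho.
Proof.
apply/seteqP; split=> w.
  by move=> [H [A [B [/semimonotone_srgP]]]]; exact.
move=> /(semimonotone_region_srg _ _ _ (dim_ge2_hilbert_plane R))[A [B ?]].
by exists (hilbert_plane R), A, B.
Qed.

(** On a fixed space the class SRG may be smaller than the region, but it is contained in it, which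
    suffices for the converse. *)
Lemma srg_full_on_semimonotone {R : realType} (H : hilbertSpace R)
    (mu rho : R) : srg_full_on (semimonotone_class mu rho H).
Proof.
move=> A B; split=> [AB w ABw|AB]; first by exists (A, B).
apply/semimonotone_srgP => w /AB [[C D] /= /semimonotone_srgP]; exact.
Qed.

Lemma srg_full_semimonotone {R : realType} (mu rho : R) :
  srg_full (semimonotone_class mu rho).
Proof.
by move=> H A B; rewrite srg_of_class_semimonotone; exact: semimonotone_srgP.
Qed.

Lemma monotone_regionE {R : realType} (mu : R) :
  semimonotone_region mu 0 =
    finite_points [set z : R[i] | complex.Re z >= mu] `|` [set infty R].
Proof.
rewrite semimonotone_regionE lexx; congr (finite_points _ `|` _).
by apply/seteqP; split=> z /=; rewrite mul0r addr0.
Qed.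

Theorem mainTheorem4 (R : realType) (mu rho : R) :
  (* the classes range over all real Hilbert spaces *)
  [/\ srg_full (semimonotone_class mu rho),
      srg_of_class (semimonotone_class mu rho) =
        (if rho <= 0
         then finite_points
                [set z : R[i] | complex.Re z >= mu + rho * normc z ^+ 2]
              `|` [set infty R]
         else finite_points
                [set z : R[i] | complex.Re z >= mu + rho * normc z ^+ 2])
    & srg_of_class (monotone_class mu) =
        finite_points [set z : R[i] | complex.Re z >= mu] `|` [set infty R]]
  /\
  (* the same on one fixed space H; the two descriptions of the SRG require
     H to contain a plane *)
  (forall H : hilbertSpace R,
     srg_full_on (semimonotone_class mu rho H) /\
     (dim_ge2 H ->
        srg_of_class_on (semimonotone_class mu rho H) =
          (if rho <= 0
           then finite_points
                  [set z : R[i] | complex.Re z >= mu + rho * normc z ^+ 2]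
                `|` [set infty R]
           else finite_points
                  [set z : R[i] | complex.Re z >= mu + rho * normc z ^+ 2])
        /\
        srg_of_class_on (monotone_class mu H) =
          finite_points [set z : R[i] | complex.Re z >= mu] `|` [set infty R])).
Proof.
split.
  split; first exact: srg_full_semimonotone.
    by rewrite srg_of_class_semimonotone semimonotone_regionE.
  by rewrite /monotone_class srg_of_class_semimonotone monotone_regionE.
move=> H; split=> [|H2]; first exact: srg_full_on_semimonotone.
split; first by rewrite srg_of_class_on_semimonotone// semimonotone_regionE.
by rewrite srg_of_class_on_semimonotone// monotone_regionE.
Qed.
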